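(* Let $p$ be a prime, let $k\geq 1$ be an integer, let $f\in F_p[x]$ be an irreducible polynomial of degree $k$, and let $K_f=F_p[x]/(f)$. Then the graph $C_f$, with the projection $\pi:C_f\to X_f$, $(y,z)\mapsto y$, is a regular covering space of the graph $X_f$.
   Context: $F_p$ is the field with $p$ elements, and the class of the polynomial $x$ in $K_f=F_p[x]/(f)$ is again denoted $x$. Let $S=\{x,x^p,x^{p^2},\dots,x^{p^{k-1}}\}\subset K_f$ be the set of conjugates of $x$, and $K_f^\times=K_f\setminus\{0\}$. The multigraph $X_f$ has vertex set $K_f$ and the following edges. For all $y,y'\in K_f$ and $s\in S$ with $y'-y=s$ there is one (additive) edge from $y$ to $y'$ corresponding to $s$. For all $y,y'\in K_f\setminus\{0\}$ and $s\in S$ with $y'y^{-1}=s$ there is one (multiplicative) edge from $y$ to $y'$ corresponding to $s$. Orientations are then forgotten, keeping every edge. The multigraph $C_f$ has vertex set $K_f\times K_f^\times$ and the following edges. For vertices $(y,z),(y',z')$ and $s\in S$ there is one (additive) edge from $(y,z)$ to $(y',z')$ corresponding to $s$ if $y'-y=s$ and $z=z'$, and one (multiplicative) edge from $(y,z)$ to $(y',z')$ corresponding to $s$ if $y,y'\neq 0$ and $y'y^{-1}=z'z^{-1}=s$. Orientations are then forgotten, keeping every edge. The projection $\pi$ sends each additive (respectively multiplicative) edge of $C_f$ corresponding to $s$ to the additive (respectively multiplicative) edge of $X_f$ corresponding to $s$ between the projected vertices. A covering of graphs is a surjective graph morphism that is, at every vertex $v$ of the source, a bijection from the edge-ends at $v$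 onto the edge-ends at the image of $v$. The covering $\pi$ is regular (in the sense of covering space theory, also called normal or Galois) if the group of covering transformations, i.e. graph automorphisms $F$ of $C_f$ with $\pi\circ F=\pi$, acts transitively on each fiber of $\pi$. Connectedness of $C_f$ is not required. *)

(* Defs.v *)
From mathcomp Require Import all_boot all_order all_fingroup all_algebra all_field.
Set Implicit Arguments.
Unset Strict Implicit.
Unset Printing Implicit Defensive.

Import GRing.Theory.
Local Open Scope ring_scope.

(* A graph with loops and multiple edges is given by its edge-ends ("darts"):
   [flip] exchanges the two ends of an edge, so an edge is an orbit {d, flip d};
   a loop contributes two distinct ends at its vertex. *)
Record graph := Graph {
  vertex : Type;
  dart : Type;
  origin : dart -> vertex;
  flip : dart -> dart;
  flipK : involutive flip;
  flip_neq : forall d, flip d <> d }.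

Record hom (G H : graph) := Hom {
  onV : vertex G -> vertex H;
  onD : dart G -> dart H;
  hom_origin : forall d, origin (onD d) = onV (origin d);
  hom_flip : forall d, onD (flip d) = flip (onD d) }.

Definition surjective_hom (G H : graph) (phi : hom G H) : Prop :=
  (forall w, exists v, onV phi v = w) /\ (forall e, exists d, onD phi d = e).

(* [onD phi] maps the ends at [v] to ends at [onV phi v] by [hom_origin]; the
   second clause says that this restriction is a bijection. *)
Definition covering (G H : graph) (phi : hom G H) : Prop :=
  surjective_hom phi /\
  forall (v : vertex G) (e : dart H), origin e = onV phi v ->
    exists! d : dart G, origin d = v /\ onD phi d = e.

Definition automorphism (G : graph) (F : hom G G) : Prop :=
  bijective (onV F) /\ bijective (onD F).

Definition deck_transformation (G H : graph) (phi : hom G H) (F : hom G G)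
    : Prop :=
  [/\ automorphism F, onV phi \o onV F =1 onV phi
    & onD phi \o onD F =1 onD phi].

(* The fibers are those over vertices and those over edge-ends; for a covering,
   transitivity on the former implies transitivity on the latter. *)
Definition regular (G H : graph) (phi : hom G H) : Prop :=
  (forall u v : vertex G, onV phi u = onV phi v ->
     exists2 F : hom G G, deck_transformation phi F & onV F u = v) /\
  (forall d e : dart G, onD phi d = onD phi e ->
     exists2 F : hom G G, deck_transformation phi F & onD F d = e).

Definition regular_covering (G H : graph) (phi : hom G H) : Prop :=
  covering phi /\ regular phi.

Record digraph := Digraph {
  dvertex : Type;
  arrow : Type;
  source : arrow -> dvertex;
  target : arrow -> dvertex }.

Definition arrow_flip (A : Type) (d : A * bool) : A * bool := (d.1, ~~ d.2).

Lemma arrow_flipK (A : Type) : involutive (@arrow_flip A).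
Proof. by case=> a b; rewrite /arrow_flip /= negbK. Qed.

Lemma arrow_flip_neq (A : Type) (d : A * bool) : arrow_flip d <> d.
Proof. by case: d => a []. Qed.

(* Forgetting orientations: each arrow [a] becomes one edge, with ends
   [(a, false)] at its source and [(a, true)] at its target. *)
Definition forget (D : digraph) : graph :=
  @Graph (dvertex D) (arrow D * bool)
    (fun d => if d.2 then target d.1 else source d.1)
    (@arrow_flip (arrow D)) (@arrow_flipK (arrow D)) (@arrow_flip_neq (arrow D)).

Section FieldGraphs.

Variables (K : finFieldType) (S : {set K}).

(* Triples are (source, target, label s). *)

Definition Xadd_pred (e : K * K * K) : bool :=
  let: (y, y', s) := e in (s \in S) && (y' - y == s).

Definition Xmul_pred (e : K * K * K) : bool :=
  let: (y, y', s) := e in [&& s \in S, y != 0, y' != 0 & y' * y^-1 == s].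

Definition Xarrow : Type := ({e | Xadd_pred e} + {e | Xmul_pred e})%type.

Definition Xends (a : Xarrow) : K * K * K :=
  match a with inl e => val e | inr e => val e end.

Definition Xdigraph : digraph :=
  @Digraph K Xarrow (fun a => (Xends a).1.1) (fun a => (Xends a).1.2).

Definition Xgraph : graph := forget Xdigraph.

Definition nonzero : Type := {z : K | z != 0}.

Definition Cvertex : Type := (K * nonzero)%type.

Definition Cadd_pred (e : Cvertex * Cvertex * K) : bool :=
  let: ((y, z), (y', z'), s) := e in
  [&& s \in S, y' - y == s & z == z'].

Definition Cmul_pred (e : Cvertex * Cvertex * K) : bool :=
  let: ((y, z), (y', z'), s) := e in
  [&& s \in S, y != 0, y' != 0, y' * y^-1 == s & val z' * (val z)^-1 == s].

Definition Carrow : Type := ({e | Cadd_pred e} + {e | Cmul_pred e})%type.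

Definition Cends (a : Carrow) : Cvertex * Cvertex * K :=
  match a with inl e => val e | inr e => val e end.

Definition Cdigraph : digraph :=
  @Digraph Cvertex Carrow (fun a => (Cends a).1.1) (fun a => (Cends a).1.2).

Definition Cgraph : graph := forget Cdigraph.

Definition proj_ends (e : Cvertex * Cvertex * K) : K * K * K :=
  (e.1.1.1, e.1.2.1, e.2).

Lemma proj_add e : Cadd_pred e -> Xadd_pred (proj_ends e).
Proof. by case: e => [[[y z] [y' z']] s] /= /and3P[-> ->]. Qed.

Lemma proj_mul e : Cmul_pred e -> Xmul_pred (proj_ends e).
Proof. by case: e => [[[y z] [y' z']] s] /= /and5P[-> -> -> ->]. Qed.

Definition proj_arrow (a : Carrow) : Xarrow :=
  match a with
  | inl e => inl (exist _ (proj_ends (val e)) (proj_add (valP e)))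
  | inr e => inr (exist _ (proj_ends (val e)) (proj_mul (valP e)))
  end.

Definition proj_dart (d : dart Cgraph) : dart Xgraph := (proj_arrow d.1, d.2).

Lemma proj_origin (d : dart Cgraph) :
  origin (proj_dart d) = (origin d : Cvertex).1.
Proof. by case: d => [[e|e] []]. Qed.

Lemma proj_flip (d : dart Cgraph) : proj_dart (flip d) = flip (proj_dart d).
Proof. by []. Qed.

Definition proj : hom Cgraph Xgraph :=
  @Hom Cgraph Xgraph (fun v : Cvertex => v.1) proj_dart proj_origin proj_flip.

End FieldGraphs.

(* [{poly %/ g with _}] requires [g] to be monic, so [F_p[x]/(f)] is formed with
   the monic generator of the ideal (f); see [class_eq0]. *)
Definition monic_assoc (F : fieldType) (f : {poly F}) : {poly F} :=
  (lead_coef f)^-1 *: f.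

Lemma monic_assocP (F : fieldType) (f : {poly F}) :
  irreducible_poly f -> monic_irreducible_poly (monic_assoc f).
Proof.
move=> hf; have lf0 : lead_coef f != 0.
  by rewrite lead_coef_eq0 irredp_neq0.
split; last by rewrite monicE lead_coefZ mulVf.
have lV0 : (lead_coef f)^-1 != 0 by rewrite invr_eq0.
case: hf => sf hf; split; first by rewrite size_scale.
move=> q sq; rewrite /monic_assoc dvdpZr // => /(hf q sq) qf.
by rewrite (eqp_trans qf) // eqp_sym eqp_scale.
Qed.

Definition Kf (p : nat) (f : {poly 'F_p}) (hf : irreducible_poly f) :
    finFieldType :=
  {poly %/ monic_assoc f with monic_assocP hf}.

Definition class (p : nat) (f : {poly 'F_p}) (hf : irreducible_poly f)
    (q : {poly 'F_p}) : Kf hf :=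
  in_qpoly (monic_assoc f) q.

Lemma class_eq0 (p : nat) (f : {poly 'F_p}) (hf : irreducible_poly f) q :
  (class hf q == 0) = (f %| q).
Proof.
have [hI hM] := monic_assocP hf.
have lV0 : (lead_coef f)^-1 != 0.
  by rewrite invr_eq0 lead_coef_eq0 irredp_neq0.
rewrite -(dvdpZl _ _ lV0) -/(monic_assoc f) /dvdp -(inj_eq val_inj) /=.
by rewrite (mk_monicE (monic_assocP hf)) Pdiv.IdomainMonic.modpE.
Qed.

Definition conjugates (p k : nat) (f : {poly 'F_p})
    (hf : irreducible_poly f) : {set Kf hf} :=
  [set class hf 'X ^+ (p ^ i)%N | i : 'I_k].

Definition X_graph (p k : nat) (f : {poly 'F_p}) (hf : irreducible_poly f) :=
  Xgraph (conjugates k hf).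

Definition C_graph (p k : nat) (f : {poly 'F_p}) (hf : irreducible_poly f) :=
  Cgraph (conjugates k hf).

Definition C_proj (p k : nat) (f : {poly 'F_p}) (hf : irreducible_poly f) :
    hom (C_graph k hf) (X_graph k hf) :=
  proj (conjugates k hf).

(* Main.v *)
Require Import Defs.
From mathcomp Require Import all_boot all_order all_fingroup all_algebra all_field.

(** The unit group [K \ {0}] acts on [C_f] by scaling the second coordinate, and
    transitively on each fiber over a vertex.  A lift of an edge of [X_f] is
    determined by one of its ends: an additive edge keeps [z], a multiplicative
    edge labelled [s] replaces [z] by [s z], where [s] is nonzero because it is
    a quotient of nonzero elements.  Transitivity on edge-ends then follows from
    unique lifting. *)

Lemma covering_regular {G H : graph} (phi : Defs.hom G H) :
  covering phi ->
  (forall u v : vertex G, onV phi u = onV phi v ->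
     exists2 F : Defs.hom G G, deck_transformation phi F & onV F u = v) ->
  regular phi.
Proof.
move=> [_ lift] trans; split=> // d e de.
have [|F deckF Fd] := trans (origin d) (origin e).
  by rewrite -!hom_origin de.
exists F => //; have [d0 [_ uniq_d0]] := lift _ _ (hom_origin phi e).
(* Both [e] and [onD F d] are ends at [origin e] lying over [onD phi e], so each equals the unique
   lift [d0]. *)
rewrite -(uniq_d0 e) //; symmetry; apply: uniq_d0; split.
  by rewrite hom_origin.
by case: deckF => _ _ /(_ d) /= ->.
Qed.

Section FieldCovering.

Import GRing.Theory.
Local Open Scope ring_scope.

Variables (K : finFieldType) (S : {set K}).

Definition nz1 : nonzero K := exist _ 1 (oner_neq0 K).

(** [nonzero] is a bare sigma type, so the group operations of $K^\times$ are set up on it by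
    hand. *)
Definition nz_mul (w z : nonzero K) : nonzero K :=
  exist _ (val w * val z) (mulf_neq0 (valP w) (valP z)).

Lemma nz_inv_subproof (w : nonzero K) : (val w)^-1 != 0.
Proof. by rewrite invr_eq0 (valP w). Qed.

Definition nz_inv (w : nonzero K) : nonzero K :=
  exist _ (val w)^-1 (nz_inv_subproof w).

Lemma nz_mulK w : cancel (nz_mul w) (nz_mul (nz_inv w)).
Proof. by move=> z; apply: val_inj; rewrite /= mulKf ?(valP w). Qed.

Lemma nz_mulVK w : cancel (nz_mul (nz_inv w)) (nz_mul w).
Proof. by move=> z; apply: val_inj; rewrite /= mulVKf ?(valP w). Qed.

Definition scaleV (w : nonzero K) (v : Cvertex K) : Cvertex K :=
  (v.1, nz_mul w v.2).

Definition scale_ends (w : nonzero K) (e : Cvertex K * Cvertex K * K) :=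
  (scaleV w e.1.1, scaleV w e.1.2, e.2).

Lemma scaleVK w : cancel (scaleV w) (scaleV (nz_inv w)).
Proof. by case=> y z; rewrite /scaleV /= nz_mulK. Qed.

Lemma scaleVVK w : cancel (scaleV (nz_inv w)) (scaleV w).
Proof. by case=> y z; rewrite /scaleV /= nz_mulVK. Qed.

Lemma scale_endsK w : cancel (scale_ends w) (scale_ends (nz_inv w)).
Proof. by case=> [[u v] s]; rewrite /scale_ends /= !scaleVK. Qed.

Lemma scale_endsVK w : cancel (scale_ends (nz_inv w)) (scale_ends w).
Proof. by case=> [[u v] s]; rewrite /scale_ends /= !scaleVVK. Qed.

Lemma scale_add w e : Cadd_pred S e -> Cadd_pred S (scale_ends w e).
Proof. by case: e => [[[y z] [y' z']] s] /and3P[/= -> -> /eqP->] /=. Qed.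

Lemma scale_mul w e : Cmul_pred S e -> Cmul_pred S (scale_ends w e).
Proof.
case: e => [[[y z] [y' z']] s] /and5P[/= -> -> -> -> /eqP <-] /=.
(* The scalar cancels: $(wz')(wz)^{-1} = z'z^{-1}$ since $K$ is commutative. *)
by rewrite invfM mulrACA divff ?(valP w) // mul1r eqxx.
Qed.

Definition scale_arrow (w : nonzero K) (a : Carrow S) : Carrow S :=
  match a with
  | inl e => inl (exist _ (scale_ends w (val e)) (scale_add w _ (valP e)))
  | inr e => inr (exist _ (scale_ends w (val e)) (scale_mul w _ (valP e)))
  end.

Lemma scale_arrowK w : cancel (scale_arrow w) (scale_arrow (nz_inv w)).
Proof.
by case=> e; [congr inl | congr inr]; apply: val_inj; rewrite /= scale_endsK.
Qed.

Lemma scale_arrowVK w : cancel (scale_arrow (nz_inv w)) (scale_arrow w).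
Proof.
by case=> e; [congr inl | congr inr]; apply: val_inj; rewrite /= scale_endsVK.
Qed.

Definition scale_dart (w : nonzero K) (d : dart (Cgraph S)) :
  dart (Cgraph S) := (scale_arrow w d.1, d.2).

Lemma scale_origin w (d : dart (Cgraph S)) :
  origin (scale_dart w d) = scaleV w (origin d).
Proof. by case: d => [[e|e] []]. Qed.

Lemma scale_flip w (d : dart (Cgraph S)) :
  scale_dart w (flip d) = flip (scale_dart w d).
Proof. by []. Qed.

Definition scale_hom (w : nonzero K) : Defs.hom (Cgraph S) (Cgraph S) :=
  @Defs.Hom (Cgraph S) (Cgraph S) (scaleV w) (scale_dart w)
    (scale_origin w) (scale_flip w).

(** Scaling by $w^{-1}$ is the inverse automorphism. The projection reads only first coordinates and
    labels, which scaling fixes. *)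
Lemma scale_deck w : deck_transformation (proj S) (scale_hom w).
Proof.
split=> //; last first.
  by case=> [[e|e] b]; [congr (inl _, _) | congr (inr _, _)]; apply: val_inj.
split; first exact: Bijective (scaleVK w) (scaleVVK w).
exists (scale_dart (nz_inv w)) => -[a b]; congr (_, _).
  exact: scale_arrowK.
exact: scale_arrowVK.
Qed.

Lemma proj_trans (u v : vertex (Cgraph S)) :
  onV (proj S) u = onV (proj S) v ->
  exists2 F : Defs.hom (Cgraph S) (Cgraph S),
    deck_transformation (proj S) F & onV F u = v.
Proof.
case: u v => [y z] [y' z'] /= <-.
(* The scalar $z'z^{-1}$ carries $z$ to $z'$. *)
exists (scale_hom (nz_mul z' (nz_inv z))); first exact: scale_deck.
by congr (_, _); apply: val_inj; rewrite /= divfK ?(valP z).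
Qed.

Lemma proj_lift (v : vertex (Cgraph S)) (e : dart (Xgraph S)) :
  origin e = onV (proj S) v ->
  exists d : dart (Cgraph S), origin d = v /\ onD (proj S) d = e.
Proof.
case: v => y z; case: e => [[[[[y1 y2] s] a]|[[[y1 y2] s] m]] b] /= yE.
- have aC : Cadd_pred S ((y1, z), (y2, z), s) by case/andP: a => /= -> ->/=.
  exists (inl (exist (fun e => Cadd_pred S e) _ aC), b); split; first by case: b yE => /= <-.
  by congr (inl _, _); apply: val_inj.
- have s0 : s != 0.
    by case/and4P: m => _ y10 y20 /eqP<-; rewrite mulf_neq0 ?invr_eq0.
  pose t : nonzero K := exist _ s s0.
  (* [z1] is the second coordinate at the source. When [b] is true the prescribed end is the target,
     so the source must carry $s^{-1}z$ for the target to carry $z$. *)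
  pose z1 := if b then nz_mul (nz_inv t) z else z.
  have mC : Cmul_pred S ((y1, z1), (y2, nz_mul t z1), s).
    by case/and4P: m => /= -> -> -> ->; rewrite mulfK ?(valP z1) /=.
  exists (inr (exist (fun e => Cmul_pred S e) _ mC), b); split.
    by case: b yE @z1 mC => /= <- _; rewrite ?nz_mulVK.
  by congr (inr _, _); apply: val_inj.
Qed.

(** Equal projections force the same kind of edge, first coordinates, label and end. The common
    origin gives one second coordinate, and the edge relation determines the other. *)
Lemma proj_lift_uniq (d d' : dart (Cgraph S)) :
  origin d = origin d' -> onD (proj S) d = onD (proj S) d' -> d = d'.
Proof.
have sV (s a b : K) : a != 0 -> b / a == s -> b = s * a.
  by move=> a0 /eqP<-; rewrite divfK.
case: d d' => [[[[[[y1 z1] [y2 z2]] s] a]|[[[[y1 z1] [y2 z2]] s] m]] b]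
  [[[[[[y1' z1'] [y2' z2']] s'] a']|[[[[y1' z1'] [y2' z2']] s'] m']] b'] //=.
- move=> vE [e1 e2 e3 e4].
  have /and3P[_ _ /eqP z12] := a; have /and3P[_ _ /eqP z12'] := a'; subst.
  congr (inl _, _); apply: val_inj => /=.
  by case: b' vE => -[->].
- move=> vE [e1 e2 e3 e4].
  have /and5P[_ _ y20 /eqP yE zE] := m.
  have /and5P[_ y10 _ _ zE'] := m'; subst.
  have s0 : y2' / y1' != 0 by rewrite mulf_neq0 ?invr_eq0.
  have {}zE := sV _ _ _ (valP z1) zE.
  have {}zE' := sV _ _ _ (valP z1') zE'.
  congr (inr _, _); apply: val_inj => /=.
  (* At a target end [z2] and [z2'] agree, and cancelling $s \neq 0$ in $s z_1 = s z_1'$ gives the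
     sources. At a source end the targets agree as $s$ times the same element. *)
  case: b' vE => -[E]; subst.
    suff -> : z1 = z1' by [].
    by apply: val_inj; apply: (mulfI s0); rewrite -zE -zE'.
  suff -> : z2 = z2' by [].
  by apply: val_inj; rewrite zE zE'.
Qed.

Lemma proj_covering : covering (proj S).
Proof.
split; last first.
  move=> v e ev; have [d [dv de]] := proj_lift v e ev.
  exists d; split=> // d' [dv' de'].
  by apply: proj_lift_uniq; rewrite (dv, de) ?(dv', de').
(* For surjectivity, $(y,1)$ serves as a base point in the fiber over $y$, and an edge-end is lifted
   at the base point over its origin. *)
split=> [y | e]; first by exists (y, nz1).
by have [|d [_ de]] := proj_lift (origin e, nz1) e; last exists d.
Qed.

Lemma proj_regular_covering : regular_covering (proj S).
Proof.
split; first exact: proj_covering.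
exact: covering_regular proj_covering proj_trans.
Qed.

End FieldCovering.

Theorem proposition9 (p k : nat) (f : {poly 'F_p}) (hp : prime p)
  (hk : (1 <= k)%N) (hf : irreducible_poly f) (hdeg : size f = k.+1) :
  regular_covering (C_proj k hf).
Proof. exact: proj_regular_covering. Qed.
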